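(* Let $\{(Y_t,X_t):t\ge1\}$, $Y_t\in\mathbb R$, $X_t\in\mathbb R^k$, have law $P_\infty^{\mathrm{obs}}$, and let $\Theta_I^{(T)}$ be the $T$-period sharp set (defined in the context). Let $\beta_0\in\mathcal B$ and $V_t=Y_t-X_t'\beta_0$. Suppose $\beta_0\in\Theta_I^{(T)}$ and that there are a deterministic constant $C_T<\infty$ and measurable functions $L_T(X^{(T)}),U_T(X^{(T)})$ such that for every $t\le T$ $$P\{L_T(X^{(T)})\le V_t\le U_T(X^{(T)})\mid X^{(T)}\}=1,\qquad U_T(X^{(T)})-L_T(X^{(T)})\le C_T\ \text{ a.s.}$$ For $d\in\mathbb R^k$ let $\omega_T(d;x^{(T)})=\max_{t\le T}x_t'd-\min_{t\le T}x_t'd$, and let $\overline\kappa_T=\inf_{\|d\|=1}\operatorname{ess\,sup}\,\omega_T(d;X^{(T)})\in[0,\infty]$. Then: (a) every $b\in\Theta_I^{(T)}$, with $d=b-\beta_0$, satisfies $\omega_T(d;X^{(T)})\le C_T$ almost surely; equivalently, $\Theta_I^{(T)}\subseteq\{\beta_0+d:\operatorname{ess\,sup}\,\omega_T(d;X^{(T)})\le C_T\}$. (b) If $0<\overline\kappa_T<\infty$, then $\Theta_I^{(T)}\subseteq\{b\in\mathcal B:\|b-\beta_0\|\le C_T/\overline\kappa_T\}$. (c) If $\overline\kappa_T=\infty$, then $\Theta_I^{(T)}=\{\beta_0\}$. (d) If, for every $T\ge1$, $\beta_0\in\Theta_I^{(T)}$ and there are a deterministic constant $C_T<\infty$ and measurable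 functions $L_T(X^{(T)}),U_T(X^{(T)})$ such that $P\{L_T(X^{(T)})\le V_t\le U_T(X^{(T)})\mid X^{(T)}\}=1$ for every $t\le T$ and $U_T(X^{(T)})-L_T(X^{(T)})\le C_T$ a.s., and if $C_T/\overline\kappa_T\to0$ as $T\to\infty$ (with $C_T/\infty:=0$), then $\bigcap_{T\ge1}\Theta_I^{(T)}=\{\beta_0\}$ and $$d_H(\Theta_I^{(T)},\{\beta_0\})=\sup_{b\in\Theta_I^{(T)}}\|b-\beta_0\|\le\frac{C_T}{\overline\kappa_T}\longrightarrow0 ,$$ where $d_H$ is the Hausdorff distance.
   Context: $\tau\in(0,1)$, $k\ge1$, $\mathcal B\subseteq\mathbb R^k$, $\|\cdot\|$ is the Euclidean norm. $Y^{(T)}=(Y_1,\dots,Y_T)'$, $X^{(T)}=(X_1,\dots,X_T)$, and $P^{\mathrm{obs}}_T$ is their law. For $b\in\mathcal B$, $\mathcal C_{T,b}(P_T^{\mathrm{obs}})$ is the set of Borel probability laws of $(Y^{(T)},X^{(T)},A)$, $A\in\mathbb R$, with $(Y^{(T)},X^{(T)})$-marginal $P_T^{\mathrm{obs}}$ and satisfying, a.s. and for every $t\le T$, $P\{Y_t-X_t'b\le A\mid X^{(T)},A\}\ge\tau$ and $P\{Y_t-X_t'b<A\mid X^{(T)},A\}\le\tau$. $\Theta_I^{(T)}=\{b\in\mathcal B:\mathcal C_{T,b}(P_T^{\mathrm{obs}})\ne\varnothing\}$. Essential suprema are with respect to the law of $X^{(T)}$. Convention: $C_T/\overline\kappa_T:=+\infty$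 if $\overline\kappa_T=0$. *)

(* Defs.v *)
From HB Require Import structures.
From mathcomp Require Import all_boot all_order all_algebra.
From mathcomp Require Import all_classical all_reals all_analysis ess_sup_inf.

Set Implicit Arguments.
Unset Strict Implicit.
Unset Printing Implicit Defensive.

Import Order.TTheory GRing.Theory Num.Theory.

Local Open Scope classical_set_scope.
Local Open Scope ring_scope.

(* Parameters b, beta0, d in R^k are row vectors. Random elements of R^k, R^T
   and (R^k)^T are tuples, for which the library provides the product of the
   Borel sigma-algebras of R, i.e. the Borel sigma-algebra of these
   finite-dimensional spaces. Periods are numbered from 0: the index t stands
   for the (t+1)-st period. *)

Definition dotp (R : realType) (k : nat) (x : k.-tuple R) (b : 'rV[R]_k) : R :=
  \sum_(j < k) tnth x j * b 0 j.

(* The library's norm `|v| on row vectors is the sup norm. *)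
Definition enorm (R : realType) (k : nat) (v : 'rV[R]_k) : R :=
  Num.sqrt (\sum_(j < k) v 0 j ^+ 2).

Section conditional_probability.
Context d d' (U : measurableType d) (V : measurableType d') (R : realType).
Variable P : probability U R.

Definition is_cond_prob (Z : U -> V) (E : set U) (g : V -> R) : Prop :=
  [/\ measurable_fun setT g,
      P.-integrable setT (EFin \o (g \o Z)) &
      forall S : set V, measurable S ->
        (\int[P]_(w in Z @^-1` S) (g (Z w))%:E)%E = P (E `&` Z @^-1` S)].

(* Versions of P(E | Z) agree a.s., so that "P(E | Z) satisfies p a.s." does
   not depend on the version. *)
Definition as_cond_prob (Z : U -> V) (E : set U) (p : set R) : Prop :=
  exists2 g : V -> R, is_cond_prob Z E g & \forall w \ae P, p (g (Z w)).

End conditional_probability.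

Section identified_set.
Context (R : realType) (T k : nat).
Local Notation covs := (T.-tuple (k.-tuple R)).
Local Notation obs := (T.-tuple R * T.-tuple (k.-tuple R))%type.

Definition resid (b : 'rV[R]_k) (t : 'I_T) (o : obs) : R :=
  tnth o.1 t - dotp (tnth o.2 t) b.

Definition cov_effect (q : obs * R) : covs * R := (q.1.2, q.2).

Definition compatible_law (tau : R) (b : 'rV[R]_k) (Pobs : probability obs R)
    : set (probability (obs * R)%type R) :=
  [set Q : probability (obs * R)%type R |
    (forall S : set obs, measurable S -> Q (fst @^-1` S) = Pobs S) /\
    forall t : 'I_T,
      as_cond_prob Q cov_effect [set q | resid b t q.1 <= q.2]
        [set p | tau <= p] /\
      as_cond_prob Q cov_effect [set q | resid b t q.1 < q.2]
        [set p | p <= tau]].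

Definition sharp_set (tau : R) (B : set 'rV[R]_k) (Pobs : probability obs R)
    : set 'rV[R]_k :=
  [set b | B b /\ compatible_law tau b Pobs !=set0].

(* The neutral elements -oo and +oo of max and min only matter when T = 0. *)
Definition omega (d : 'rV[R]_k) (x : covs) : \bar R :=
  (\big[maxe/-oo]_(t < T) (dotp (tnth x t) d)%:E -
   \big[mine/+oo]_(t < T) (dotp (tnth x t) d)%:E)%E.

Definition kappa (PX : probability covs R) : \bar R :=
  ereal_inf [set ess_sup PX (omega d) | d in [set d | enorm d = 1]].

End identified_set.

(* In the library C * 0^-1 is 0 when C = 0, hence the separate case; also
   C / +oo = 0. *)
Definition width_ratio (R : realType) (C : R) (kap : \bar R) : \bar R :=
  if kap == 0%E then +oo%E else (C%:E / kap)%E.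

Definition edist (R : realType) (k : nat) (x y : 'rV[R]_k) : \bar R :=
  (enorm (x - y))%:E.

Definition hausdorff_dist (R : realType) (k : nat) (A B : set 'rV[R]_k)
    : \bar R :=
  maxe (ereal_sup [set ereal_inf [set edist a b | b in B] | a in A])
       (ereal_sup [set ereal_inf [set edist a b | a in A] | b in B]).

Section process.
Context dO (Omega : measurableType dO) (R : realType) (k : nat).
Variable P : probability Omega R.
Variables (Y : nat -> {RV P >-> R}) (X : nat -> {RV P >-> k.-tuple R}).

Definition Xvec (T : nat) (w : Omega) : T.-tuple (k.-tuple R) :=
  [tuple X t w | t < T].

Definition YXvec (T : nat) (w : Omega) :
    T.-tuple R * T.-tuple (k.-tuple R) :=
  ([tuple Y t w | t < T], Xvec T w).

Lemma measurable_Xvec T : measurable_fun setT (Xvec T).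
Proof.
apply/measurable_fun_tnthP => t.
rewrite (_ : _ \o _ = X t); first exact: measurable_funPT.
by apply/funext => w /=; rewrite tnth_mktuple.
Qed.

HB.instance Definition _ T :=
  isMeasurableFun.Build _ _ _ _ (Xvec T) (@measurable_Xvec T).

Lemma measurable_YXvec T : measurable_fun setT (YXvec T).
Proof.
apply: measurable_fun_pair; last exact: measurable_Xvec.
apply/measurable_fun_tnthP => t.
rewrite (_ : _ \o _ = Y t); first exact: measurable_funPT.
by apply/funext => w /=; rewrite tnth_mktuple.
Qed.

HB.instance Definition _ T :=
  isMeasurableFun.Build _ _ _ _ (YXvec T) (@measurable_YXvec T).

Definition lawX (T : nat) : probability (T.-tuple (k.-tuple R)) R :=
  distribution P (Xvec T).

Definition law_obs (T : nat) :
    probability (T.-tuple R * T.-tuple (k.-tuple R))%type R :=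
  distribution P (YXvec T).

Definition Theta (tau : R) (B : set 'rV[R]_k) (T : nat) : set 'rV[R]_k :=
  sharp_set tau B (law_obs T).

Definition bounded_support (beta0 : 'rV[R]_k) (T : nat) (C : R)
    (L U : T.-tuple (k.-tuple R) -> R) : Prop :=
  let V t w := Y t w - dotp (X t w) beta0 in
  [/\ measurable_fun setT L, measurable_fun setT U,
      forall t : 'I_T,
        as_cond_prob P (Xvec T)
          [set w | L (Xvec T w) <= V t w <= U (Xvec T w)] [set p | p = 1] &
      \forall w \ae P, U (Xvec T w) - L (Xvec T w) <= C].

End process.

(* Main.v *)
(* Write d = b - beta0, so that Y_t - X_t'b = V_t - X_t'd. Under a law
   compatible with b, the quantile restrictions with 0 < tau < 1 confine A to
   [L - X_t'd, U - X_t'd] for every t. These intervals, all of length at most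
   C, therefore have a common point, and their centres differ by at most C: this
   is (a). Normalising d turns this into kappa * |d| <= C, and (b), (c) and (d)
   follow. *)
Require Import Defs.
From HB Require Import structures.
From mathcomp Require Import all_boot all_order all_algebra.
From mathcomp Require Import all_classical all_reals all_analysis ess_sup_inf.
From mathcomp Require Import measurable_realfun lra.
Set Implicit Arguments.
Unset Strict Implicit.
Unset Printing Implicit Defensive.

Import Order.TTheory GRing.Theory Num.Theory.

Local Open Scope classical_set_scope.
Local Open Scope ring_scope.

(** * Almost sure statements: comparison of integrals and transfer along a map *)

Section almost_everywhere.
Context d (T : measurableType d) (R : realType).
Variable P : probability T R.

(** Deleting the null set that contains the exceptions changes neither integral, and off it the
    comparison is pointwise. *)
Lemma ae_le_integral (D : set T) (f g : T -> \bar R) : measurable D ->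
  P.-integrable D f -> P.-integrable D g ->
  (\forall x \ae P, D x -> (f x <= g x)%E) ->
  (\int[P]_(x in D) f x <= \int[P]_(x in D) g x)%E.
Proof.
move=> mD fi gi [N [mN PN0 fgN]].
rewrite (negligible_integral mN)// (negligible_integral mN mD gi)//.
apply: le_integral.
- exact: measurableD.
- by apply: integrableS fi => //; exact: measurableD.
- by apply: integrableS gi => //; exact: measurableD.
- move=> x; rewrite inE => -[Dx Nx]; apply: contrapT => fgx.
  by apply/Nx/fgN => /=; tauto.
Qed.

Lemma ae_notP (A : set T) : measurable A ->
  (\forall x \ae P, ~ A x) <-> P A = 0%E.
Proof.
move=> mA; split=> [[N [mN PN0 AN]]|PA0].
  by apply: (subset_measure0 mA mN _ PN0) => x Ax; apply: AN => /=; tauto.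
by exists A; split => // x /= /contrapT.
Qed.

End almost_everywhere.

(** Asking only that [P'] agree with the image of [P] on measurable sets lets this serve both the
    marginal condition in [compatible_law] and the laws of the process. *)
Lemma ae_preimageP d d' (T : measurableType d) (T' : measurableType d')
    (R : realType) (P : probability T R) (P' : probability T' R) (f : T -> T')
    (A : set T') :
  measurable_fun setT f -> (forall S, measurable S -> P (f @^-1` S) = P' S) ->
  measurable A -> (\forall y \ae P', A y) <-> (\forall x \ae P, A (f x)).
Proof.
move=> mf Pf mA.
have mfA : measurable (f @^-1` (~` A)).
  by rewrite -[_ @^-1` _]setTI; apply: mf => //; exact: measurableC.
have hP' : (\forall y \ae P', A y) <-> P' (~` A) = 0%E.
  rewrite -ae_notP; last exact: measurableC.
  by split; apply: filterS => y /=; [move=> ? | move/contrapT].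
have hP : (\forall x \ae P, A (f x)) <-> P (f @^-1` (~` A)) = 0%E.
  rewrite -ae_notP//.
  by split; apply: filterS => y /=; [move=> ? | move/contrapT].
by rewrite hP' hP Pf//; exact: measurableC.
Qed.

(** * What bounds on a conditional probability imply for null sets *)

Section conditional_probability.
Context d d' (U : measurableType d) (V : measurableType d') (R : realType).
Variable P : probability U R.
Variables (Z : U -> V) (E : set U).
Hypotheses (mZ : measurable_fun setT Z) (mE : measurable E).

Let mpreimage (S : set V) : measurable S -> measurable (Z @^-1` S).
Proof. by move=> mS; rewrite -[_ @^-1` _]setTI; exact: mZ. Qed.

Let integrable_cst (r : R) (D : set U) : measurable D ->
  P.-integrable D (cst r%:E).
Proof.
exact: finite_measure_integrable_cst.
Qed.

(** Integrating [tau <= g] over the event that [Z] lies in [S] gives tau P(Z in S) <= P(E and Z in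
    S) = 0, and tau is positive. *)
Lemma cond_prob_lower_null (tau : R) (S : set V) :
  0 < tau -> as_cond_prob P Z E [set p | tau <= p] -> measurable S ->
  (\forall w \ae P, S (Z w) -> ~ E w) -> \forall w \ae P, ~ S (Z w).
Proof.
move=> tau0 [g [mg gi gE] gtau] mS SE.
apply/(ae_notP P (mpreimage mS)).
have ES0 : P (E `&` Z @^-1` S) = 0%E.
  apply/ae_notP; first by apply: measurableI => //; exact: mpreimage.
  by apply: filterS SE => w SEw [Ew Sw]; exact: SEw.
have : (tau%:E * P (Z @^-1` S) <= 0)%E.
  rewrite -ES0 -gE// -integral_cst; last exact: mpreimage.
  apply: ae_le_integral; first exact: mpreimage.
  - by apply: integrable_cst; exact: mpreimage.
  - by apply: integrableS gi => //; exact: mpreimage.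
  - by apply: filterS gtau => w /= tg _; rewrite lee_fin.
rewrite pmule_rle0 ?lte_fin// => PS0.
by apply/eqP; rewrite eq_le PS0 measure_ge0.
Qed.

(** Dually, [E] has full probability within the event that [Z] lies in [S], so p = P(Z in S)
    satisfies p <= tau p with tau < 1. *)
Lemma cond_prob_upper_null (tau : R) (S : set V) :
  tau < 1 -> as_cond_prob P Z E [set p | p <= tau] -> measurable S ->
  (\forall w \ae P, S (Z w) -> E w) -> \forall w \ae P, ~ S (Z w).
Proof.
move=> tau1 [g [mg gi gE] gtau] mS SE.
have mZS := mpreimage mS.
apply/(ae_notP P mZS).
have ES : P (E `&` Z @^-1` S) = P (Z @^-1` S).
  apply/esym; rewrite (measureDI P mZS mE) setIC.
  rewrite [X in (X + _)%E](_ : _ = 0%E) ?add0e//.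
  apply/ae_notP; first exact: measurableD.
  by apply: filterS SE => w SEw [Sw nEw]; exact/nEw/SEw.
have : (P (Z @^-1` S) <= tau%:E * P (Z @^-1` S))%E.
  rewrite -[leLHS]ES -gE// -integral_cst//.
  apply: ae_le_integral => //.
  - by apply: integrableS gi.
  - exact: integrable_cst.
  - by apply: filterS gtau => w /= tg _; rewrite lee_fin.
(* Finiteness of p is what allows rewriting p <= tau p as (1 - tau) p <= 0 in [R]. *)
have /fineK <- : P (Z @^-1` S) \is a fin_num by exact: fin_num_measure.
rewrite -EFinM lee_fin => PS; congr EFin.
have PS0 : 0 <= fine (P (Z @^-1` S)) by rewrite fine_ge0.
apply/eqP; rewrite eq_le PS0 andbT -(@pmulr_rle0 _ (1 - tau)) ?subr_gt0//.
by rewrite mulrBl mul1r subr_le0.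
Qed.

(** Integrating the version over the whole space gives P(E) = 1. This removes the conditioning on X
    from the support hypothesis. *)
Lemma cond_prob1_ae :
  as_cond_prob P Z E [set p | p = 1] -> \forall w \ae P, E w.
Proof.
move=> [g [mg gi gE] g1].
have PE1 : P E = 1%E.
  rewrite -[E]setIT -[setT in LHS](preimage_setT Z) -gE//.
  rewrite preimage_setT (ae_eq_integral (cst 1%E))//.
  - by rewrite integral_cst// mul1e; exact: probability_setT.
  - by case/integrableP: gi.
  - by apply: filterS g1 => w /= -> _.
have : P (~` E) = 0%E by rewrite probability_setC// PE1 subee.
move/(ae_notP P (measurableC mE)); apply: filterS => w /=.
exact: contrapT.
Qed.

End conditional_probability.

(** * The range [omega], the Euclidean norm and [kappa] *)

Section omega.
Context (R : realType) (T k : nat).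
Hypothesis T_gt0 : (0 < T)%N.
Implicit Types (d : 'rV[R]_k) (x : T.-tuple (k.-tuple R)) (C : R).

Lemma omega_ge d x (s t : 'I_T) :
  ((dotp (tnth x s) d - dotp (tnth x t) d)%:E <= omega d x)%E.
Proof.
rewrite EFinB /omega; apply: leeB.
  exact: (le_bigmax _ (fun t => (dotp (tnth x t) d)%:E)).
exact: (Order.TotalTheory.bigmin_le _ _ (fun t => (dotp (tnth x t) d)%:E)).
Qed.

Lemma omega_ge0 d x : (0 <= omega d x)%E.
Proof.
by have := omega_ge d x (Ordinal T_gt0) (Ordinal T_gt0); rewrite subrr.
Qed.

(** Finitely many real inequalities replace the extended-real max and min: comparing two periods
    yields exactly these, and they make measurability and scaling immediate. *)
Lemma omega_leP d x C :
  (forall s t, dotp (tnth x s) d - dotp (tnth x t) d <= C) <->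
  (omega d x <= C%:E)%E.
Proof.
split=> [dC|dC s t]; last first.
  by rewrite -lee_fin; apply: le_trans dC; exact: omega_ge.
rewrite /omega; set m := (\big[mine/_]_(t < T) _)%E.
(* Having at least one period keeps the minimum below [+oo], so it can be moved across the
   inequality. *)
have m_fin : m \is a fin_num.
  rewrite fin_numElt; apply/andP; split.
    by apply: lt_bigmin => // i _; rewrite ltNyr.
  apply: le_lt_trans (ltry (dotp (tnth x (Ordinal T_gt0)) d)).
  exact: (Order.TotalTheory.bigmin_le _ _ (fun t => (dotp (tnth x t) d)%:E)).
rewrite leeBlDr//; apply: bigmax_le => [|s _]; first exact: leNye.
rewrite -leeBlDl//; apply: le_bigmin => [|t _]; first exact: leey.
by rewrite -EFinB lee_fin lerBlDl -lerBlDr.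
Qed.

Lemma dotpB (y : k.-tuple R) d d' : dotp y (d - d') = dotp y d - dotp y d'.
Proof.
rewrite /dotp -sumrB; apply: eq_bigr => i _.
by rewrite !mxE mulrBr.
Qed.

Lemma dotpZ (y : k.-tuple R) (a : R) d : dotp y (a *: d) = a * dotp y d.
Proof.
rewrite /dotp mulr_sumr; apply: eq_bigr => i _.
by rewrite mxE mulrCA.
Qed.

Lemma enormZ (a : R) d : 0 <= a -> enorm (a *: d) = a * enorm d.
Proof.
move=> a0; rewrite /enorm -[a in RHS]ger0_norm// -sqrtr_sqr -sqrtrM ?sqr_ge0//.
rewrite mulr_sumr; congr Num.sqrt; apply: eq_bigr => i _.
by rewrite mxE exprMn.
Qed.

Lemma enorm_gt0 d : (0 < enorm d) = (d != 0).
Proof.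
rewrite /enorm sqrtr_gt0 lt_neqAle eq_sym sumr_ge0 ?andbT; last first.
  by move=> i _; exact: sqr_ge0.
rewrite psumr_eq0; last by move=> i _; exact: sqr_ge0.
congr negb; apply/allP/eqP => [d0|-> i _].
  apply/rowP => i; rewrite mxE; apply/eqP.
  by rewrite -sqrf_eq0; apply: d0; exact: mem_index_enum.
by rewrite mxE expr0n /=.
Qed.

Lemma enorm0 : enorm (0 : 'rV[R]_k) = 0.
Proof. by rewrite -(scale0r 0) enormZ// mul0r. Qed.

Lemma enorm_eq0 d : enorm d = 0 -> d = 0.
Proof.
by move=> d0; apply: contrapT => /eqP; rewrite -enorm_gt0 d0 ltxx.
Qed.

Variable PX : probability (T.-tuple (k.-tuple R)) R.

Let PX_gt0 : (0 < PX setT)%E.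
Proof. by rewrite probability_setT. Qed.

Lemma ess_sup_omega_ge0 d : (0 <= ess_sup PX (omega d))%E.
Proof. by apply: ess_sup_gee => //; apply: aeW; exact: omega_ge0. Qed.

Lemma kappa_ge0 : (0 <= kappa PX)%E.
Proof. by apply/ereal_infP => _ [d _ <-]; exact: ess_sup_omega_ge0. Qed.

(** The unit vector d / |d| competes in the infimum, and [omega] is positively homogeneous in its
    direction. *)
Lemma kappa_le_div d C : d != 0 -> (ess_sup PX (omega d) <= C%:E)%E ->
  (kappa PX <= (C / enorm d)%:E)%E.
Proof.
rewrite -enorm_gt0 => d0 /ess_supP dC.
apply: ge_ereal_inf; exists (ess_sup PX (omega ((enorm d)^-1 *: d))).
  exists ((enorm d)^-1 *: d) => //=.
  by rewrite enormZ ?invr_ge0 ?(ltW d0)// mulVf// gt_eqF.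
apply/ess_supP; apply: filterS dC => x /omega_leP dC.
apply/omega_leP => s t.
by rewrite !dotpZ -mulrBr mulrC ler_pM2r ?invr_gt0//; exact: dC.
Qed.

Lemma enorm_le_width_ratio d C : (ess_sup PX (omega d) <= C%:E)%E ->
  ((enorm d)%:E <= width_ratio C (kappa PX))%E.
Proof.
(* Nonnegativity of [C] settles d = 0 below, where the ratio only has to be nonnegative. *)
move=> dC; have C0 : 0 <= C.
  by rewrite -lee_fin; apply: le_trans dC; exact: ess_sup_omega_ge0.
rewrite /width_ratio; case: ifPn => [_|kappa0]; first exact: leey.
have [->|d0] := eqVneq d 0.
  by rewrite enorm0 mule_ge0// ?lee_fin// inve_ge0 kappa_ge0.
have := kappa_le_div d0 dC; have := kappa_ge0; move: kappa0.
(* Only a real value survives: [+oo] contradicts the bound C / |d|, and [-oo] contradicts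
   [kappa_ge0]. *)
case: (kappa PX) => // r; rewrite !eqe !lee_fin => r0 r_ge0.
have r_gt0 : 0 < r by rewrite lt_neqAle eq_sym r0.
rewrite inver (negbTE r0) -EFinM lee_fin.
rewrite -enorm_gt0 in d0.
by rewrite !ler_pdivlMr// => ?; rewrite mulrC.
Qed.

Lemma kappay_eq0 d C : kappa PX = +oo%E ->
  (ess_sup PX (omega d) <= C%:E)%E -> d = 0.
Proof.
move=> ky dC; apply: contrapT => /eqP /kappa_le_div /(_ dC).
by rewrite ky leye_eq.
Qed.

End omega.

(** * Measurability of the events and maps involved *)

Section measurability.
Context (R : realType) (T k : nat).
Local Notation covs := (T.-tuple (k.-tuple R)).

Lemma measurable_set_le d (V : measurableType d) (f g : V -> R) :
  measurable_fun setT f -> measurable_fun setT g ->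
  measurable [set v | f v <= g v].
Proof.
move=> mf mg; rewrite -preimage_true -[_ @^-1` _]setTI.
exact: (measurable_fun_ler mf mg).
Qed.

Lemma measurable_set_lt d (V : measurableType d) (f g : V -> R) :
  measurable_fun setT f -> measurable_fun setT g ->
  measurable [set v | f v < g v].
Proof.
move=> mf mg; rewrite -preimage_true -[_ @^-1` _]setTI.
exact: (measurable_fun_ltr mf mg).
Qed.

Lemma measurable_dotp (t : 'I_T) (b : 'rV[R]_k) :
  measurable_fun setT (fun x : covs => dotp (tnth x t) b).
Proof.
apply: measurable_sum => j; apply: measurable_funM => //.
by apply: measurableT_comp (measurable_tnth j) _; exact: measurable_tnth.
Qed.

Lemma measurable_omega_le (d : 'rV[R]_k) (C : R) : (0 < T)%N ->
  measurable [set x : covs | (omega d x <= C%:E)%E].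
Proof.
move=> T_gt0; rewrite (_ : [set x | _] = \bigcap_(s : 'I_T) \bigcap_(t : 'I_T)
    [set x : covs | dotp (tnth x s) d - dotp (tnth x t) d <= C]).
  apply: fin_bigcap_measurable => // s _; apply: fin_bigcap_measurable => // t _.
  apply: measurable_set_le => //.
  by apply: measurable_funB; exact: measurable_dotp.
apply/seteqP; split=> x /= xC.
  by move=> s _ t _; exact: (omega_leP T_gt0 d x C).2.
by apply/omega_leP => // s t; exact: xC.
Qed.

Lemma measurable_resid (b : 'rV[R]_k) (t : 'I_T) :
  measurable_fun setT (@resid R T k b t).
Proof.
apply: measurable_funB.
  by apply: measurableT_comp (measurable_tnth t) _; exact: measurable_fst.
by apply: measurableT_comp (measurable_dotp t b) _; exact: measurable_snd.
Qed.

Lemma measurable_cov_effect : measurable_fun setT (@cov_effect R T k).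
Proof.
apply: measurable_fun_pair; last exact: measurable_snd.
by apply: measurableT_comp measurable_snd _; exact: measurable_fst.
Qed.

End measurability.

(** * Quantile restrictions bound the differences of the covariate indices *)

Section spread.
Context (R : realType) (T k : nat).
Local Notation covs := (T.-tuple (k.-tuple R)).
Local Notation obs := (T.-tuple R * T.-tuple (k.-tuple R))%type.
Variables (tau : R) (b beta0 : 'rV[R]_k) (Pobs : probability obs R).
Variables (L U : covs -> R).
Hypotheses (tau01 : 0 < tau < 1).
Hypotheses (mL : measurable_fun setT L) (mU : measurable_fun setT U).
Hypothesis LU : forall t,
  \forall o \ae Pobs, L o.2 <= resid beta0 t o <= U o.2.

Let d := b - beta0.

Let resid_shift t (o : obs) :
  resid b t o = resid beta0 t o - dotp (tnth o.2 t) d.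
Proof. by rewrite /resid dotpB opprB addrA subrK. Qed.

Lemma measurable_residual_bounds t :
  measurable [set o : obs | L o.2 <= resid beta0 t o <= U o.2].
Proof.
rewrite (_ : [set o | _] =
  [set o : obs | L o.2 <= resid beta0 t o] `&`
  [set o : obs | resid beta0 t o <= U o.2]); last first.
  by apply/seteqP; split=> o /=; [move/andP | move=> ?; apply/andP].
have mr := measurable_resid beta0 t.
apply: measurableI; apply: measurable_set_le => //.
- by apply: measurableT_comp mL _; exact: measurable_snd.
- by apply: measurableT_comp mU _; exact: measurable_snd.
Qed.

Lemma measurable_spread (c : 'rV[R]_k) s t :
  measurable [set o : obs |
    dotp (tnth o.2 s) c - dotp (tnth o.2 t) c <= U o.2 - L o.2].
Proof.
apply: measurable_set_le; apply: measurable_funB.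
- by apply: measurableT_comp (measurable_dotp s c) _; exact: measurable_snd.
- by apply: measurableT_comp (measurable_dotp t c) _; exact: measurable_snd.
- by apply: measurableT_comp mU _; exact: measurable_snd.
- by apply: measurableT_comp mL _; exact: measurable_snd.
Qed.

(* No law (Y,X,A) compatible with b puts A below L - X_t'd, where Y_t - X_t'b
   would exceed A surely, nor above U - X_t'd, where it would lie below A
   surely. *)
Lemma effect_bounds (Q : probability (obs * R)%type R) (t : 'I_T) :
  compatible_law tau b Pobs Q ->
  \forall q \ae Q, L q.1.2 - dotp (tnth q.1.2 t) d <= q.2
                   <= U q.1.2 - dotp (tnth q.1.2 t) d.
Proof.
move=> [Qobs /(_ t)[cond_le cond_lt]].
have /andP[tau0 tau1] := tau01.
have mZ := @measurable_cov_effect R T k.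
have mr : measurable_fun setT (fun q : obs * R => resid b t q.1).
  by apply: measurableT_comp (measurable_resid b t) _; exact: measurable_fst.
have mshift (f : covs -> R) : measurable_fun setT f ->
    measurable_fun setT (fun z : covs * R => f z.1 - dotp (tnth z.1 t) d).
  move=> mf; apply: measurable_funB.
    by apply: measurableT_comp mf _; exact: measurable_fst.
  by apply: measurableT_comp (measurable_dotp t d) _; exact: measurable_fst.
have LUQ : \forall q \ae Q, L q.1.2 <= resid beta0 t q.1 <= U q.1.2.
  apply/(ae_preimageP (f := fst) _ Qobs (measurable_residual_bounds t)).
    exact: measurable_fst.
  exact: LU.
(* Since [L] is a function of X alone, this event depends only on (X,A), so it is an admissible
   conditioning event [S]; likewise for [upper]. *)
have lower : \forall q \ae Q, ~ (q.2 < L q.1.2 - dotp (tnth q.1.2 t) d).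
  apply: (cond_prob_lower_null mZ _ tau0 cond_le
    (S := [set z | z.2 < L z.1 - dotp (tnth z.1 t) d])).
  - by apply: measurable_set_le => //; exact: measurable_snd.
  - by apply: measurable_set_lt; [exact: measurable_snd|exact: mshift].
  - apply: filterS LUQ => q /andP[Lr _] /= qL /le_lt_trans /(_ qL).
    by rewrite resid_shift ltrD2r ltNge Lr.
have upper : \forall q \ae Q, ~ (U q.1.2 - dotp (tnth q.1.2 t) d < q.2).
  apply: (cond_prob_upper_null mZ _ tau1 cond_lt
    (S := [set z | U z.1 - dotp (tnth z.1 t) d < z.2])).
  - by apply: measurable_set_lt => //; exact: measurable_snd.
  - by apply: measurable_set_lt; [exact: mshift|exact: measurable_snd].
  - apply: filterS LUQ => q /andP[_ rU] /= Uq.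
    by apply: le_lt_trans Uq; rewrite resid_shift lerD2r.
apply: filterS2 lower upper => q /negP + /negP.
by rewrite -!leNgt => -> ->.
Qed.

(** The same A serves all periods: L - X_t'd <= A <= U - X_s'd eliminates it. What remains concerns
    the observables only, so it passes from [Q] back to the marginal [Pobs]. *)
Lemma sharp_spread : compatible_law tau b Pobs !=set0 -> forall s t,
  \forall o \ae Pobs,
    dotp (tnth o.2 s) d - dotp (tnth o.2 t) d <= U o.2 - L o.2.
Proof.
move=> [Q Qb] s t.
apply/(ae_preimageP (P := Q) (f := fst)).
- exact: measurable_fst.
- exact: Qb.1.
- exact: measurable_spread.
apply: filterS2 (effect_bounds s Qb) (effect_bounds t Qb) => q.
move=> /andP[_ qs] /andP[qt _].
by rewrite lerBrDr addrAC lerBlDr; lra.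
Qed.

End spread.

(** * Bounds on the sharp set of the process at a fixed horizon *)

Section process.
Context dO (Omega : measurableType dO) (R : realType) (k : nat).
Variable P : probability Omega R.
Variables (Y : nat -> {RV P >-> R}) (X : nat -> {RV P >-> k.-tuple R}).
Variables (tau : R) (B : set 'rV[R]_k) (beta0 : 'rV[R]_k).
Hypothesis tau01 : 0 < tau < 1.

Section fixed_horizon.
Variables (T : nat) (C : R) (L U : T.-tuple (k.-tuple R) -> R).
Hypothesis T_gt0 : (0 < T)%N.
Hypothesis LU : bounded_support Y X beta0 C L U.

Lemma Theta_omega_le b : Theta Y X tau B T b ->
  \forall w \ae P, (omega (b - beta0) (Xvec X T w) <= C%:E)%E.
Proof.
case: LU => mL mU LUV UL [_ Qb].
have mYX : measurable_fun setT (YXvec Y X T) by exact: measurable_YXvec.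
(* The conditional support hypothesis becomes an almost sure statement under [P], then one under the
   law of the observables. *)
have LUobs t : \forall o \ae law_obs Y X T, L o.2 <= resid beta0 t o <= U o.2.
  have mLU := measurable_residual_bounds beta0 mL mU t.
  apply/(ae_preimageP (P := P) mYX) => //.
  have := cond_prob1_ae _ (LUV t).
  rewrite (_ : [set w | _] = YXvec Y X T @^-1`
      [set o | L o.2 <= resid beta0 t o <= U o.2]); last first.
    by apply/funext => w /=; rewrite /resid !tnth_mktuple.
  by apply; rewrite -[_ @^-1` _]setTI; exact: mYX.
have spread s t : \forall w \ae P,
    dotp (tnth (Xvec X T w) s) (b - beta0) -
    dotp (tnth (Xvec X T w) t) (b - beta0) <= C.
  have /(ae_preimageP (P := P) (P' := law_obs Y X T) mYX (fun _ _ => erefl)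
    (measurable_spread mL mU _ _ _)) := sharp_spread tau01 mL mU LUobs Qb s t.
  by move/filterS2; apply; last exact: UL; move=> w; exact: le_trans.
have : \forall w \ae P, forall s t, dotp (tnth (Xvec X T w) s) (b - beta0) -
    dotp (tnth (Xvec X T w) t) (b - beta0) <= C.
  (* There are finitely many pairs of periods, so one null set covers all exceptions. *)
  by apply: filter_forall => s; apply: filter_forall => t; exact: spread.
by apply: filterS => w /omega_leP; apply.
Qed.

Lemma Theta_ess_sup_le b : Theta Y X tau B T b ->
  (ess_sup (lawX X T) (omega (b - beta0)) <= C%:E)%E.
Proof.
move=> /Theta_omega_le bC.
have mX : measurable_fun setT (Xvec X T) by exact: measurable_Xvec.
apply/ess_supP.
apply/(ae_preimageP (P := P) (P' := lawX X T) mX (fun _ _ => erefl)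
  (measurable_omega_le (b - beta0) C T_gt0)).
exact: bC.
Qed.

Lemma Theta_enorm_le b : Theta Y X tau B T b ->
  ((enorm (b - beta0))%:E <= width_ratio C (kappa (lawX X T)))%E.
Proof. by move=> /Theta_ess_sup_le; exact: enorm_le_width_ratio. Qed.

End fixed_horizon.
End process.

(** Because [a0] belongs to [A], the distance from [a0] to [A] is at most [edist a0 a0], one of the
    values in the supremum; hence the other one-sided term attains the max. *)
Lemma hausdorff_dist1 (R : realType) (k : nat) (A : set 'rV[R]_k) a0 : A a0 ->
  hausdorff_dist A [set a0] = ereal_sup [set (enorm (a - a0))%:E | a in A].
Proof.
move=> Aa0; rewrite /hausdorff_dist.
have -> : [set ereal_inf [set Defs.edist a b | b in [set a0]] | a in A] =
    [set (enorm (a - a0))%:E | a in A].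
  by apply: eq_imagel => a _; rewrite image_set1 ereal_inf1.
apply/max_idPl; rewrite image_set1 ereal_sup1.
apply: ge_ereal_inf; exists (Defs.edist a0 a0); first by exists a0.
by apply: ereal_sup_ubound; exists a0.
Qed.

Theorem theorem7p5 (R : realType) (dO : measure_display)
    (Omega : measurableType dO) (P : probability Omega R) (k : nat)
    (Y : nat -> {RV P >-> R}) (X : nat -> {RV P >-> k.-tuple R})
    (tau : R) (B : set 'rV[R]_k) (beta0 : 'rV[R]_k)
    (hk : (0 < k)%N) (htau : 0 < tau < 1) (hbeta0 : B beta0) :
  (forall (T : nat) (C : R) (L U : T.-tuple (k.-tuple R) -> R),
    (0 < T)%N ->
    Theta Y X tau B T beta0 ->
    bounded_support Y X beta0 C L U ->
    [/\ (forall b, Theta Y X tau B T b ->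
           \forall w \ae P, (omega (b - beta0) (Xvec X T w) <= C%:E)%E) /\
        Theta Y X tau B T `<=`
          [set beta0 + d | d in
             [set d | (ess_sup (lawX X T) (omega d) <= C%:E)%E]],
        (0 < kappa (lawX X T) < +oo)%E ->
        Theta Y X tau B T `<=`
          [set b | B b /\
             ((enorm (b - beta0))%:E <= width_ratio C (kappa (lawX X T)))%E] &
        kappa (lawX X T) = +oo%E -> Theta Y X tau B T = [set beta0]]) /\
  (forall C : nat -> R,
    (forall T : nat, (0 < T)%N ->
       Theta Y X tau B T beta0 /\
       exists L U : T.-tuple (k.-tuple R) -> R,
         bounded_support Y X beta0 (C T) L U) ->
    (fun T => width_ratio (C T) (kappa (lawX X T))) @ \oo --> 0%E ->
    [/\ \bigcap_(T in [set T | (0 < T)%N]) Theta Y X tau B T = [set beta0],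
        forall T : nat, (0 < T)%N ->
          hausdorff_dist (Theta Y X tau B T) [set beta0] =
            ereal_sup [set (enorm (b - beta0))%:E | b in Theta Y X tau B T] /\
          (ereal_sup [set (enorm (b - beta0))%:E | b in Theta Y X tau B T] <=
            width_ratio (C T) (kappa (lawX X T)))%E &
        (fun T => hausdorff_dist (Theta Y X tau B T) [set beta0])
          @ \oo --> 0%E]).
Proof.
split=> [T C L U T0 Tbeta0 LU|C TC ratio0].
  split=> [||ky].
  - split=> [b|b Tb]; first exact: Theta_omega_le LU b.
    by exists (b - beta0); [exact: Theta_ess_sup_le LU b Tb|rewrite addrC subrK].
  - by move=> _ b Tb; split; [case: Tb|exact: Theta_enorm_le LU b Tb].
  - apply/seteqP; split=> [b Tb|_ ->//].
    apply/subr0_eq.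
    exact: kappay_eq0 ky (Theta_ess_sup_le htau T0 LU Tb).
have bound T b : (0 < T)%N -> Theta Y X tau B T b ->
    ((enorm (b - beta0))%:E <= width_ratio (C T) (kappa (lawX X T)))%E.
  by move=> T0 Tb; have [_ [L [U LU]]] := TC T T0; exact: Theta_enorm_le LU b Tb.
have sup_le T : (0 < T)%N ->
    (ereal_sup [set (enorm (b - beta0))%:E | b in Theta Y X tau B T] <=
      width_ratio (C T) (kappa (lawX X T)))%E.
  by move=> T0; apply: ge_ereal_sup => _ [b Tb <-]; exact: bound.
have hausdorffE T : (0 < T)%N -> hausdorff_dist (Theta Y X tau B T) [set beta0] =
    ereal_sup [set (enorm (b - beta0))%:E | b in Theta Y X tau B T].
  by move=> T0; apply: hausdorff_dist1; exact: (TC T T0).1.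
split.
- apply/seteqP; split=> [b Tb|_ -> T T0]; last exact: (TC T T0).1.
  apply/subr0_eq/enorm_eq0/eqP; rewrite eq_le sqrtr_ge0 andbT -lee_fin.
  (* The number |b - beta0| does not depend on T and lies below every ratio with T >= 1, hence below
     their limit 0. *)
  apply: (cvge_to_ge ratio0).
  by exists 1%N => // T /= T0; apply: bound => //; exact: Tb.
- by move=> T T0; split; [exact: hausdorffE|exact: sup_le].
- apply: squeeze_cvge (cvg_cst 0%E) ratio0.
  exists 1%N => // T /= T0; rewrite hausdorffE// sup_le// andbT.
  (* The lower bound 0 is the value at [beta0], a member of the set; the supremum of an empty set
     would be [-oo]. *)
  apply: ereal_sup_ubound; exists beta0; first exact: (TC T T0).1.
  by rewrite subrr enorm0.
Qed.
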